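(* Let $X$ be a continuum with metric $d$ and let $F\colon X\to 2^X$ be an upper semicontinuous function. If $F$ is Li-Yorke sensitive, then $F$ is sensitive.
   Context: A continuum is a connected compact metric space. $2^X$ denotes the family of all nonempty closed subsets of $X$, and $\mathcal{H}$ denotes the Hausdorff metric on $2^X$ induced by $d$; $\mathbb N=\{1,2,3,\ldots\}$. A function $F\colon X\to 2^X$ is upper semicontinuous if for each $x\in X$ and every open $V\subseteq X$ with $F(x)\subseteq V$, there is an open $U\subseteq X$ with $x\in U$ and $F(y)\subseteq V$ for all $y\in U$. For $A\subseteq X$, $F(A)=\bigcup\{F(x):x\in A\}$; $F^1=F$ and $F^{n+1}(x)=F(F^n(x))$ for $x\in X$, $n\in\mathbb N$ (if $F$ is upper semicontinuous, then each $F^n(x)\in 2^X$). For $x\in X$ and $r>0$, $\mathcal{V}_r(x)=\{y\in X : d(x,y)<r\}$. $F$ is Li-Yorke sensitive if there exists $\varepsilon>0$ such that for each $x\in X$ and $\delta>0$ there exists $y\in\mathcal{V}_\delta(x)$ such that $\liminf_{n\to\infty}\mathcal{H}(F^n(x),F^n(y))=0$ and $\limsup_{n\to\infty}\mathcal{H}(F^n(x),F^n(y))>\varepsilon$. $F$ is sensitive if there exists $\varepsilon>0$ such that for each $x\in X$ and $\delta>0$ there exist $y\in\mathcal{V}_\delta(x)$ and $m\in\mathbb N$ such that $\mathcal{H}(F^m(x),F^m(y))\geq\varepsilon$. *)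

(* Defs.v *)
From mathcomp Require Import all_boot all_order all_algebra.
From mathcomp Require Import all_classical all_reals all_analysis.

Set Implicit Arguments.
Unset Strict Implicit.
Unset Printing Implicit Defensive.

Import Order.TTheory GRing.Theory Num.Theory.

Local Open Scope classical_set_scope.
Local Open Scope ring_scope.

Definition continuum (R : realType) (X : metricType R) : Prop :=
  compact [set: X] /\ connected [set: X].

(* The hyperspace 2^X. *)
Definition hyperspace (X : topologicalType) : set (set X) :=
  [set A | A !=set0 /\ closed A].
Arguments hyperspace : clear implicits.

Definition thickening (R : realType) (X : metricType R) (A : set X) (r : R) :
  set X := \bigcup_(a in A) ball a r.

(* [inf] is the infimum of a set of reals, with junk value 0 on empty or
   unbounded below sets; the set below is bounded below by 0, and it is
   nonempty when A and B are nonempty and X is bounded, e.g. compact. *)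
Definition hausdorff_dist (R : realType) (X : metricType R) (A B : set X) : R :=
  inf [set r | [/\ 0 < r, A `<=` thickening B r & B `<=` thickening A r]].

Definition upper_semicontinuous_multifun (X : topologicalType)
    (F : X -> set X) : Prop :=
  forall (x : X) (V : set X), open V -> F x `<=` V ->
    exists U : set X, [/\ open U, U x & forall y, U y -> F y `<=` V].

Definition multifun_image (X : Type) (F : X -> set X) (A : set X) : set X :=
  \bigcup_(x in A) F x.

(* By convention the 0-th iterate is x |-> [set x]; only the iterates of
   index n >= 1 are relevant below. *)
Definition multifun_iter (X : Type) (F : X -> set X) (n : nat) (x : X) :
  set X := iter n (multifun_image F) [set x].

Lemma multifun_iter1 (X : Type) (F : X -> set X) (x : X) :
  multifun_iter F 1 x = F x.
Proof. by rewrite /multifun_iter /= /multifun_image bigcup_set1. Qed.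

Lemma multifun_iterS (X : Type) (F : X -> set X) (n : nat) (x : X) :
  multifun_iter F n.+1 x = multifun_image F (multifun_iter F n x).
Proof. by []. Qed.

Definition orbit_dist (R : realType) (X : metricType R) (F : X -> set X)
    (x y : X) (n : nat) : R :=
  hausdorff_dist (multifun_iter F n x) (multifun_iter F n y).

Definition Li_Yorke_sensitive (R : realType) (X : metricType R)
    (F : X -> set X) : Prop :=
  exists2 e : R, 0 < e & forall (x : X) (delta : R), 0 < delta ->
    exists y : X, [/\ ball x delta y,
      limn_einf (fun n => (orbit_dist F x y n)%:E) = 0%E &
      (e%:E < limn_esup (fun n => (orbit_dist F x y n)%:E))%E].

Definition sensitive (R : realType) (X : metricType R)
    (F : X -> set X) : Prop :=
  exists2 e : R, 0 < e & forall (x : X) (delta : R), 0 < delta ->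
    exists (y : X) (m : nat),
      [/\ ball x delta y, (0 < m)%N & e <= orbit_dist F x y m].

(* Main.v *)
Require Import Defs.
From mathcomp Require Import all_boot all_order all_algebra.
From mathcomp Require Import all_classical all_reals all_analysis.

(** The Li-Yorke constant itself serves: a limsup is at most the supremum of any tail, so a limsup
    above [e] forces a term above [e] in every tail. *)

Lemma lt_limn_esup_exists (R : realType) (u : (\bar R)^nat) (e : \bar R) (N : nat) :
  (e < limn_esup u)%E -> exists2 m : nat, (N <= m)%N & (e < u m)%E.
Proof.
rewrite /limn_esup limf_esupE => e_lt.
have /ereal_sup_gt[_ [m /= Nm <-] ltm] :
    (e < ereal_sup [set u n | n in [set n | (N <= n)%N]])%E.
  (* The limsup is an infimum of suprema over neighbourhoods of infinity; the tail from [N] is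
     one. *)
  apply: (Order.POrderTheory.lt_le_trans e_lt); apply: ereal_inf_lbound => /=.
  exists [set n | (N <= n)%N]%classic => //.
  exact: nbhs_infty_ge.
by exists m.
Qed.

Theorem proposition6p6 (R : realType) (X : metricType R) (F : X -> set X)
    (contX : continuum X)
    (F_hyperspace : forall x : X, hyperspace X (F x))
    (F_usc : upper_semicontinuous_multifun F) :
  Li_Yorke_sensitive F -> sensitive F.
Proof.
case=> e e_gt0 LY; exists e => // x delta /(LY x)[y [xy _]].
(* Cutting the tail at 1 discards the conventional iterate of index 0. *)
case/(lt_limn_esup_exists _ _ _ 1) => m m_gt0; rewrite lte_fin => e_lt.
by exists y, m; split=> //; exact: Order.POrderTheory.ltW.
Qed.
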